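(* Let $L\in\mathcal{L}$. Then: (1) The mapping $\mathcal{L}(\pi)\ni M\mapsto D_{\chi^2}(M\|L)$ (resp. $D_{-1}(L\|M)$) admits a unique minimizer $M^f$, given for $x\neq y\in\mathcal{X}$ by $$M^f(x,y)=\left(\frac{L(x,y)^{-1}+L_\pi(x,y)^{-1}}{2}\right)^{-1}=P_{-1}(x,y).$$ (2) The mapping $\mathcal{L}(\pi)\ni M\mapsto D_{\chi^2}(L\|M)$ (resp. $D_{-1}(M\|L)$) admits a unique minimizer $M^{f^*}$, given for $x\neq y\in\mathcal{X}$ by $$M^{f^*}(x,y)=\left(\frac{L(x,y)^{2}+L_\pi(x,y)^{2}}{2}\right)^{1/2}=P_{2}(x,y).$$ (3) (Pythagorean identity) For any $\overline{M}\in\mathcal{L}(\pi)$, $$D_{\chi^2}(L\|\overline{M})=D_{\chi^2}(L\|M^{f^*})+D_{\chi^2}(M^{f^*}\|\overline{M}),$$ $$D_{\chi^2}(\overline{M}\|L)=D_{\chi^2}(\overline{M}\|M^f)+D_{\chi^2}(M^f\|L).$$ (4) (Bisection property) $$D_{\chi^2}(L\|M^{f^*})=D_{\chi^2}(L_\pi\|M^{f^*}),\qquad D_{\chi^2}(M^f\|L)=D_{\chi^2}(M^f\|L_\pi).$$ (5) (Parallelogram law) For any $\overline{M}\in\mathcal{L}(\pi)$, $$D_{\chi^2}(L\|\overline{M})+D_{\chi^2}(L_\pi\|\overline{M})=2D_{\chi^2}(L\|M^{f^*})+2D_{\chi^2}(M^{f^*}\|\overline{M}),$$ $$D_{\ch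i^2}(\overline{M}\|L)+D_{\chi^2}(\overline{M}\|L_\pi)=2D_{\chi^2}(\overline{M}\|M^f)+2D_{\chi^2}(M^f\|L).$$
   Context: $\mathcal{X}$ is a finite set and $\pi$ is a fixed probability distribution on $\mathcal{X}$ with $\pi(x)>0$ for all $x$. $\mathcal{L}$ is the set of Markov infinitesimal generators on $\mathcal{X}$, i.e. $\mathcal{X}\times\mathcal{X}$ real matrices with non-negative off-diagonal entries and all row sums zero. $\mathcal{L}(\pi)\subseteq\mathcal{L}$ is the set of $\pi$-reversible generators, i.e. those $M$ with $\pi(x)M(x,y)=\pi(y)M(y,x)$ for all $x,y$. The $\pi$-dual $L_\pi$ of $L\in\mathcal{L}$ is the generator with off-diagonal entries $L_\pi(x,y)=\frac{\pi(y)}{\pi(x)}L(y,x)$, $x\neq y$, and diagonal entries such that all row sums are zero. For $M,L\in\mathcal{L}$ and convex $f$ with $f(1)=0$, the $f$-divergence is $$D_f(M\|L):=\sum_{x\in\mathcal{X}}\pi(x)\sum_{y\in\mathcal{X}\setminus\{x\}}L(x,y)\,f\!\left(\frac{M(x,y)}{L(x,y)}\right),$$ with the convention $0f(a/0)=0$ for $a\ge 0$. For $\alpha\in\mathbb{R}\setminus\{0,1\}$ let $f_\alpha(t):=\frac{t^\alpha-\alpha t-(1-\alpha)}{\alpha(\alpha-1)}$ (with $f_\alpha(0)$ the limit as $t\to0^+$, possibly $+\infty$). The paper takes the $\chi^2$-divergence to be $D_{\chi^2}:=D_{f_2}$ with $f_2(t)=(t-1)^2$, and $D_{-1}:=D_{f_{-1}}$.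 (Constant positive prefactors in these generators, such as $1/2$, do not affect the statements.) For $p\in\mathbb{R}\setminus\{0\}$ the power mean reversiblization $P_p$ has off-diagonal entries $P_p(x,y)=\left(\frac{L(x,y)^p+L_\pi(x,y)^p}{2}\right)^{1/p}$, $x\ne y$, and diagonal entries such that all row sums are zero; for $p<0$ the expression is understood by continuity as $0$ if $L(x,y)=0$ or $L_\pi(x,y)=0$. The minimizers $M^f$ and $M^{f^*}$ likewise have diagonal entries determined by zero row sums.
   Formalization: The convention 0f(a/0)=0 is kept only for a=0; for a>0 it is replaced by 0f(a/0):=a·lim_{t→∞} f(t)/t (possibly +∞), since otherwise M=0 gives D_f(L‖M)=0 and the claims fail. Divergences are extended-real valued. *)

(* Defs.v *)
From mathcomp Require Import all_boot all_order all_algebra.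
From mathcomp Require Import all_classical all_reals all_analysis.
Set Implicit Arguments.
Unset Strict Implicit.
Unset Printing Implicit Defensive.
Import Order.TTheory GRing.Theory Num.Theory.
Import numFieldNormedType.Exports.
Local Open Scope classical_set_scope.
Local Open Scope ring_scope.

Section Generators.
Context {R : realType} {X : finType}.
Implicit Types (K L M : X -> X -> R) (pi : X -> R).

Definition generator : set (X -> X -> R) :=
  [set L | (forall x y, x != y -> 0 <= L x y) /\
           (forall x, \sum_(y : X) L x y = 0)].

Definition reversible_generator pi : set (X -> X -> R) :=
  [set M | generator M /\ forall x y, pi x * M x y = pi y * M y x].

Definition zero_row_sums K : X -> X -> R :=
  fun x y => if x == y then - \sum_(z | z != x) K x z else K x y.

Definition dual pi L : X -> X -> R :=
  zero_row_sums (fun x y => pi y / pi x * L y x).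

(* As 0 `^ p = 0 for every p != 0 in the library, the value at a zero argument
   for p < 0 (the limit 0) has to be given separately. *)
Definition power_mean (p a b : R) : R :=
  if (p < 0) && ((a == 0) || (b == 0)) then 0
  else ((a `^ p + b `^ p) / 2) `^ p^-1.

Definition power_mean_reversiblization pi L (p : R) : X -> X -> R :=
  zero_row_sums (fun x y => power_mean p (L x y) (dual pi L x y)).

End Generators.

Section Divergences.
Context {R : realType}.
Implicit Types (f : R -> \bar R).
Local Open Scope ereal_scope.

(* l f(m / l). For l = 0 this is the lower semicontinuous extension
   0 f(m / 0) = m lim_(t -> +oo) f(t) / t, so that 0 f(0 / 0) = 0.
   Taking instead 0 f(m / 0) = 0 for m > 0 would make the zero generator a
   minimizer of M |-> D_f(L || M), with value 0, for every L and f >= 0. *)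
Definition perspective f (m l : R) : \bar R :=
  if l == 0%R then m%:E * lim (f t * (t^-1)%:E @[t --> +oo%R])
  else l%:E * f (m / l)%R.

Definition fdiv {X : finType} (pi : X -> R) f (M L : X -> X -> R) : \bar R :=
  \sum_(x : X) (pi x)%:E * \sum_(y | y != x) perspective f (M x y) (L x y).

(* When M vanishes wherever L does (off the diagonal), no convention on
   0 f(a / 0) with a > 0 is involved. *)
Lemma fdiv_dominated (X : finType) (pi : X -> R) f (M L : X -> X -> R) :
  (forall x y, x != y -> L x y = 0%R -> M x y = 0%R) ->
  fdiv pi f M L = \sum_(x : X) (pi x)%:E *
    \sum_(y | y != x) (L x y)%:E * f (M x y / L x y)%R.
Proof.
move=> ML; rewrite /fdiv; apply: eq_bigr => x _; congr (_ * _).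
apply: eq_bigr => y yx; rewrite /perspective.
by case: eqP => // L0; rewrite ML 1?eq_sym // L0 !mul0e.
Qed.

Definition f_chi2 (t : R) : \bar R := ((t - 1) ^+ 2)%:E.

Definition f_alpha_real (alpha t : R) : R :=
  ((t `^ alpha - alpha * t - (1 - alpha)) / (alpha * (alpha - 1)))%R.

Definition f_alpha (alpha t : R) : \bar R :=
  if t == 0%R then lim ((f_alpha_real alpha s)%:E @[s --> (0:R)^'+])
  else (f_alpha_real alpha t)%:E.

Definition unique_minimizer {T : Type} (A : set T) (F : T -> \bar R) (m : T) :=
  [/\ A m,
      forall M, A M -> F m <= F M &
      forall M, A M -> (forall N, A N -> F M <= F N) -> M = m].

End Divergences.

Notation D_chi2 pi := (fdiv pi f_chi2).
Notation D_m1 pi := (fdiv pi (f_alpha (-1))).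

(* Main.v *)
Require Import Defs.
From mathcomp Require Import all_boot all_order all_algebra.
From mathcomp Require Import all_classical all_reals all_analysis.
From mathcomp Require Import ring lra.
Set Implicit Arguments.
Unset Strict Implicit.
Unset Printing Implicit Defensive.
Import Order.TTheory GRing.Theory Num.Theory.
Import numFieldNormedType.Exports.
Local Open Scope classical_set_scope.
Local Open Scope ring_scope.

(** After multiplication by [pi x], the flow [pi x * L x y] of the dual of [L] is
    the flow of [L] with the arrow reversed, so a reversible generator is a
    self-dual one, and a divergence does not change when both arguments are
    replaced by their duals: this only exchanges the terms of (x, y) and (y, x),
    because [perspective f] is homogeneous of degree 1 ([fdiv_dual]). Hence a
    reversible [M] has the same divergence to (or from) [L] and its dual, which
    is the bisection property, and the sum of these two equal divergences can be
    studied term by term.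

    For one pair (x, y) the chi-square term is (m - l)^2 / l. With a = L x y,
    b = Lpi x y and m = M x y,

      (m - a)^2 / a + (m - b)^2 / b = m^2 (1/a + 1/b) - 4 m + a + b,
      (a - m)^2 / m + (b - m)^2 / m = (a^2 + b^2) / m - 2 (a + b) + 2 m

    depend on m as 2 (m - c)^2 / c and 2 (c - m)^2 / m do, where c is the
    harmonic mean of a and b in the first line and their quadratic mean in the
    second; the remainder is the value at m = c ([chi2_harmonic_mean],
    [chi2_quadratic_mean]). The zero cases agree as well: the harmonic mean
    vanishes when one of a, b does, the quadratic mean when both do, which is
    exactly when the left-hand sides are infinite (for m > 0) or finite (for
    m = 0), respectively. Summation gives the parallelogram laws, and bisection
    halves them into the Pythagorean identities.

    The Pythagorean identity makes its foot the unique minimizer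
    ([unique_minimizer_pythagoras]), because the divergence is finite there and
    the other term is nonnegative and separates generators. The statements on
    the divergence of index -1 follow, since the perspective of f_(-1) is half that
    of the chi-square generator with its arguments exchanged ([D_m1E]). *)

(** * Positive factors in extended sums *)

(** A positive real factor distributes even over +oo - oo, whose conventional
    value -oo it fixes. This lets the weights [pi x] enter the inner sums for an arbitrary [f]. *)
Lemma gt0_muleDr (R : realType) (w : R) (x y : \bar R) : 0 < w ->
  (w%:E * (x + y) = w%:E * x + w%:E * y)%E.
Proof.
move=> w0; have w0E : (0 < w%:E)%E by rewrite lte_fin.
by case: x y => [x| |] [y| |] //=;
  rewrite ?(addeNy, addNye, gt0_muley, gt0_muleNy) // -?EFinD -?EFinM
    ?mulrDr ?EFinD.
Qed.

Lemma gt0_sume_distrr (R : realType) (I : Type) (s : seq I) (P : pred I)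
    (w : R) (F : I -> \bar R) : 0 < w ->
  (w%:E * \sum_(i <- s | P i) F i = \sum_(i <- s | P i) w%:E * F i)%E.
Proof.
move=> w0; apply: (big_morph _ _ (mule0 _)) => x y.
exact: gt0_muleDr.
Qed.

Lemma mul2e (R : realType) (x : \bar R) : (2%:E * x = x + x)%E.
Proof. by rewrite mule_natl mule2n. Qed.

Lemma halve_parallelogram (R : realType) (x y z : \bar R) :
  (x + x = 2%:E * y + (z + z))%E -> x = (y + z)%E.
Proof.
rewrite -!mul2e -gt0_muleDr // => /(congr1 (mule (2^-1)%:E)).
by rewrite !muleA -EFinM mulVf // !mul1e.
Qed.

(** * Perspectives of the two generators *)

Section PerspectiveValues.
Context {R : realType}.
Local Notation chi2 := (perspective (@f_chi2 R)).

Lemma perspective_homogeneous (f : R -> \bar R) (w m l : R) : w != 0 ->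
  (w%:E * perspective f m l)%E = perspective f (w * m) (w * l).
Proof.
move=> w0; rewrite /perspective mulf_eq0 (negbTE w0) /=.
case: eqVneq => [_|l0]; rewrite muleA -EFinM //.
by rewrite -mulf_div divff // mul1r.
Qed.

(** The slope is (t - 1)^2 / t >= t - 2, so the chi-square divergence penalizes
    infinitely any mass put where the second argument vanishes. *)
Lemma chi2_slope_pinfty :
  lim (@f_chi2 R t * (t^-1)%:E @[t --> +oo%R])%E = +oo%E.
Proof.
apply/cvg_lim => //; under eq_cvg do rewrite /f_chi2 -EFinM.
apply/cvgeryP/cvgryPge => A; near=> t.
have t0 : 0 < t by near: t; apply: nbhs_pinfty_gt; exact: num_real.
have At : A + 2 < t by near: t; apply: nbhs_pinfty_gt; exact: num_real.
rewrite ler_pdivlMr //; nra.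
Unshelve. all: by end_near. Qed.

Lemma perspective_chi2_gt0 (m l : R) : 0 < l ->
  chi2 m l = ((m - l) ^+ 2 / l)%:E.
Proof.
move=> l0; rewrite /perspective gt_eqF // /f_chi2 -EFinM; congr _%:E.
by field; rewrite gt_eqF.
Qed.

Lemma perspective_chi2_pinfty (m : R) : 0 < m -> chi2 m 0 = +oo%E.
Proof.
by move=> m0; rewrite /perspective eqxx chi2_slope_pinfty gt0_muley ?lte_fin.
Qed.

Lemma perspective_chi2_00 : chi2 0 0 = 0%E.
Proof. by rewrite /perspective eqxx mul0e. Qed.

(** The three regimes of the chi-square perspective on nonnegative arguments;
    the first two indices let a case analysis substitute the zero arguments. *)
Variant chi2_spec (m l : R) : R -> R -> \bar R -> Prop :=
  | Chi2Pos of 0 < l : chi2_spec m l m l ((m - l) ^+ 2 / l)%:E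
  | Chi2Infty of l = 0 & 0 < m : chi2_spec m l m 0 +oo%E
  | Chi2Null of l = 0 & m = 0 : chi2_spec m l 0 0 0%E.

Lemma chi2P (m l : R) : 0 <= m -> 0 <= l -> chi2_spec m l m l (chi2 m l).
Proof.
rewrite le_eqVlt => m0; rewrite le_eqVlt => /predU1P[l0|l0]; last first.
  by rewrite perspective_chi2_gt0 //; constructor.
case/predU1P: m0 => [<-|m0].
  by rewrite -l0 perspective_chi2_00; constructor.
by rewrite -l0 perspective_chi2_pinfty //; constructor.
Qed.

Lemma perspective_chi2_ge0 (m l : R) : 0 <= m -> 0 <= l -> (0 <= chi2 m l)%E.
Proof.
move=> m0 l0; case: chi2P => // {}l0.
by rewrite lee_fin divr_ge0 ?sqr_ge0 ?ltW.
Qed.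

Lemma perspective_chi2_eq0 (m l : R) : 0 <= m -> 0 <= l ->
  chi2 m l = 0%E -> m = l.
Proof.
move=> m0 l0; case: chi2P => // {}l0 [] /eqP.
by rewrite mulf_eq0 invr_eq0 (gt_eqF l0) orbF sqrf_eq0 subr_eq0 => /eqP.
Qed.

Lemma perspective_chi2_lty (m l : R) : 0 <= m -> 0 <= l ->
  (l = 0 -> m = 0) -> (chi2 m l < +oo)%E.
Proof.
move=> m0 l0; case: chi2P => // [{}l0 _|_ {}m0 /(_ erefl) me0].
  exact: ltry.
by rewrite me0 ltxx in m0.
Qed.

(** Near 0+, f_(-1)(t) = (1/t + t - 2) / 2 exceeds (1/t - 2) / 2. *)
Lemma f_alpha_m1_at0 : f_alpha (-1) (0 : R) = +oo%E.
Proof.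
rewrite /f_alpha eqxx; apply/cvg_lim => //.
apply/cvgeryP/cvgryPge => A; near=> t.
have B0 : 0 < 2 * `|A| + 2 by rewrite ltr_wpDl // mulr_ge0.
have t0 : 0 < t by near: t; exact: nbhs_right_gt.
(* This bound on t makes (1/t - 2) / 2 larger than `|A|. *)
have At : t < (2 * `|A| + 2)^-1.
  by near: t; apply: nbhs_right_lt; rewrite invr_gt0.
rewrite /f_alpha_real powR_inv1 ?ltW //.
have : 2 * `|A| + 2 < t^-1 by rewrite -ltf_pV2 ?invrK ?posrE ?invr_gt0.
have -> : (-1) * (-1 - 1) = 2 :> R by ring.
have := ler_norm A; lra.
Unshelve. all: by end_near. Qed.

Lemma f_alpha_m1_gt0 (t : R) : 0 < t ->
  f_alpha (-1) t = ((t - 1) ^+ 2 / (2 * t))%:E.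
Proof.
move=> t0; rewrite /f_alpha gt_eqF // /f_alpha_real powR_inv1 ?ltW//.
by congr _%:E; field; rewrite gt_eqF.
Qed.

(** The slope is (1 - 1/t)^2 / 2. *)
Lemma f_alpha_m1_slope_pinfty :
  lim (f_alpha (-1) (t : R) * (t^-1)%:E @[t --> +oo%R])%E = (2^-1)%:E.
Proof.
apply/cvg_lim => //.
have V0 : (t : R)^-1 @[t --> +oo] --> (0 : R).
  apply/gtr0_cvgV0; first by apply: nbhs_pinfty_gt; exact: num_real.
  exact: cvg_id.
have cv : ((1 - t^-1) * (1 - t^-1) * 2^-1)%:E @[t --> +oo]
    --> ((1 - 0) * (1 - 0) * 2^-1 : R)%:E.
  apply: cvg_EFin; first by near=> t.
  by apply: cvgMl; apply: cvgM; apply: cvgB => //; exact: cvg_cst.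
move: cv; rewrite subr0 !mul1r => cv.
apply: cvg_trans cv; apply: near_eq_cvg; near=> t.
have t0 : 0 < t by near: t; apply: nbhs_pinfty_gt; exact: num_real.
rewrite f_alpha_m1_gt0 // -EFinM; congr _%:E.
by field; rewrite gt_eqF.
Unshelve. all: by end_near. Qed.

(** For positive arguments l f_(-1)(m / l) = (m - l)^2 / (2 m). The limits in
    the two definitions make this persist at 0: the slope 1/2 at +oo gives
    (m - 0)^2 / (2 m) = m / 2 at l = 0, and f_(-1)(0) = +oo gives the infinite
    slope of the chi-square generator at m = 0. *)
Lemma perspective_f_alpha_m1 (m l : R) : 0 <= m -> 0 <= l ->
  perspective (f_alpha (-1)) m l = ((2^-1)%:E * chi2 l m)%E.
Proof.
move=> m0 l0; rewrite {1}/perspective f_alpha_m1_slope_pinfty.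
have [l_eq0|l_neq0] := eqVneq l 0.
  rewrite l_eq0; have [->|m_neq0] := eqVneq m 0.
    by rewrite perspective_chi2_00 mul0e mule0.
  have m_gt0 : 0 < m by rewrite lt_neqAle eq_sym m_neq0.
  rewrite perspective_chi2_gt0 // -!EFinM; congr _%:E.
  by field.
have l_gt0 : 0 < l by rewrite lt_neqAle eq_sym l_neq0.
have [->|m_neq0] := eqVneq m 0.
  rewrite perspective_chi2_pinfty // mul0r f_alpha_m1_at0.
  by rewrite !gt0_muley ?lte_fin ?invr_gt0.
have m_gt0 : 0 < m by rewrite lt_neqAle eq_sym m_neq0.
rewrite perspective_chi2_gt0 // f_alpha_m1_gt0 ?divr_gt0 // -!EFinM; congr _%:E.
by field; rewrite m_neq0.
Qed.

End PerspectiveValues.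

(** * Power means and the two-point parallelogram laws *)

Section PowerMeans.
Context {R : realType}.
Local Notation chi2 := (perspective (@f_chi2 R)).
Implicit Types (p a b m w : R).

Lemma power_mean_ge0 p a b : 0 <= power_mean p a b.
Proof. by rewrite /power_mean; case: ifP => // _; exact: powR_ge0. Qed.

Lemma power_meanC p a b : power_mean p a b = power_mean p b a.
Proof. by rewrite /power_mean orbC addrC. Qed.

Lemma power_mean_homogeneous p w a b : p != 0 -> 0 < w -> 0 <= a -> 0 <= b ->
  power_mean p (w * a) (w * b) = w * power_mean p a b.
Proof.
move=> p0 w0 a0 b0; rewrite /power_mean !mulf_eq0 gt_eqF //=.
case: (_ && _).
  by rewrite mulr0.
rewrite (powRM _ (ltW w0) a0) (powRM _ (ltW w0) b0) -mulrDr -mulrA.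
rewrite powRM ?powR_ge0 //; last first.
  by rewrite divr_ge0 // addr_ge0 // powR_ge0.
by rewrite -powRrM divff // powRr1 ?ltW.
Qed.

Lemma power_mean_m1 a b : 0 <= a -> 0 <= b ->
  power_mean (-1) a b =
  if (a == 0) || (b == 0) then 0 else ((a^-1 + b^-1) / 2)^-1.
Proof.
move=> a0 b0; rewrite /power_mean ltrN10 /=; case: ifP => // _.
rewrite !powR_inv1 // invrN invr1 powR_inv1 //.
by rewrite divr_ge0 // addr_ge0 // invr_ge0.
Qed.

Lemma power_mean_2 a b : 0 <= a -> 0 <= b ->
  power_mean 2 a b = Num.sqrt ((a ^+ 2 + b ^+ 2) / 2).
Proof.
move=> a0 b0; rewrite /power_mean ltNge ler0n /= !powR_mulrn // powR12_sqrt //.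
by rewrite divr_ge0 // addr_ge0 // exprn_ge0.
Qed.

Lemma power_mean_m1_eq0 a b : 0 <= a -> 0 <= b -> a = 0 \/ b = 0 ->
  power_mean (-1) a b = 0.
Proof.
by move=> a0 b0 ab0; rewrite power_mean_m1 //;
  case: ab0 => ->; rewrite eqxx ?orbT.
Qed.

Lemma power_mean_2_eq0 a b : 0 <= a -> 0 <= b -> power_mean 2 a b = 0 ->
  a = 0 /\ b = 0.
Proof.
move=> a0 b0; rewrite power_mean_2 // => /eqP; rewrite sqrtr_eq0 => ab.
have := sqr_ge0 a; have := sqr_ge0 b => b2 a2.
have /eqP : a ^+ 2 = 0 by lra.
have /eqP : b ^+ 2 = 0 by lra.
by rewrite !sqrf_eq0 => /eqP-> /eqP->.
Qed.

(** As functions of m > 0, both sides are m^2 (1/a + 1/b) - 4 m + const, as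
    2/c = 1/a + 1/b; if a or b is 0, then c = 0 and both are infinite. *)
Lemma chi2_harmonic_mean m a b : 0 <= m -> 0 <= a -> 0 <= b ->
  let c := power_mean (-1) a b in
  (chi2 m a + chi2 m b = 2%:E * chi2 m c + (chi2 c a + chi2 c b))%E.
Proof.
move=> m0 a0 b0 c.
have [c_eq0|ab_neq0] := boolP ((a == 0) || (b == 0)).
  have -> : c = 0 by rewrite /c power_mean_m1 // c_eq0.
  have [->|m_neq0] := eqVneq m 0.
    by rewrite perspective_chi2_00 mule0 add0e.
  have m_gt0 : 0 < m by rewrite lt_neqAle eq_sym m_neq0.
  have chi2_neqNy x y : 0 <= x -> 0 <= y -> chi2 x y != -oo%E.
    move=> x0 y0; rewrite -ltNye.
    by rewrite (lt_le_trans _ (perspective_chi2_ge0 x0 y0)).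
  rewrite perspective_chi2_pinfty // gt0_muley // addye; last first.
    by rewrite adde_eq_ninfty negb_or !chi2_neqNy.
  by case/orP: c_eq0 => /eqP->;
    rewrite perspective_chi2_pinfty // (addye, addey) // chi2_neqNy.
have /norP[a_neq0 b_neq0] := ab_neq0.
have a_gt0 : 0 < a by rewrite lt_neqAle eq_sym a_neq0.
have b_gt0 : 0 < b by rewrite lt_neqAle eq_sym b_neq0.
have cE : c = 2 * (a * b) / (a + b).
  rewrite /c power_mean_m1 // (negbTE ab_neq0); field.
  by rewrite a_neq0 b_neq0 gt_eqF ?addr_gt0.
have c_gt0 : 0 < c by rewrite cE divr_gt0 ?addr_gt0 ?mulr_gt0.
rewrite !perspective_chi2_gt0 // -EFinM -!EFinD; congr _%:E; rewrite cE; field.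
by rewrite a_neq0 b_neq0 gt_eqF ?addr_gt0.
Qed.

(** As functions of m > 0, both sides are (a^2 + b^2) / m + 2 m + const, as
    2 c^2 = a^2 + b^2; at m = 0 both are infinite unless a = b = 0, that is,
    unless c = 0. *)
Lemma chi2_quadratic_mean m a b : 0 <= m -> 0 <= a -> 0 <= b ->
  let c := power_mean 2 a b in
  (chi2 a m + chi2 b m = 2%:E * chi2 c m + (chi2 a c + chi2 b c))%E.
Proof.
move=> m0 a0 b0 c.
have c_ge0 : 0 <= c := power_mean_ge0 _ _ _.
have [c_eq0|c_neq0] := eqVneq c 0.
  have [-> ->] := power_mean_2_eq0 a0 b0 c_eq0.
  rewrite c_eq0 perspective_chi2_00 !adde0.
  by rewrite mul2e.
have c_gt0 : 0 < c by rewrite lt_neqAle eq_sym c_neq0.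
have cc : c ^+ 2 = (a ^+ 2 + b ^+ 2) / 2.
  by rewrite /c power_mean_2 // sqr_sqrtr // divr_ge0 // addr_ge0 // sqr_ge0.
have [->|m_neq0] := eqVneq m 0.
  rewrite (perspective_chi2_pinfty c_gt0) gt0_muley // addye; last first.
    by rewrite !perspective_chi2_gt0.
  have [a_eq0|a_neq0] := eqVneq a 0; last first.
    rewrite perspective_chi2_pinfty 1?lt_neqAle 1?eq_sym ?a_neq0 // addye //.
    by case: chi2P.
  have [b_eq0|b_neq0] := eqVneq b 0.
    move: cc; rewrite a_eq0 b_eq0 expr0n /= addr0 mul0r => /eqP.
    by rewrite sqrf_eq0 (negbTE c_neq0).
  rewrite (@perspective_chi2_pinfty _ b) 1?lt_neqAle 1?eq_sym ?b_neq0 // addey //.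
  by case: chi2P.
have m_gt0 : 0 < m by rewrite lt_neqAle eq_sym m_neq0.
rewrite !perspective_chi2_gt0 // -EFinM -!EFinD; congr _%:E.
have b2 : b ^+ 2 = 2 * c ^+ 2 - a ^+ 2 by rewrite cc; field.
rewrite !sqrrB b2; field.
by rewrite m_neq0 c_neq0.
Qed.

End PowerMeans.

(** * Generators and duality *)

Section Duality.
Context {R : realType} {X : finType} (pi : X -> R).
Hypothesis pi_gt0 : forall x, 0 < pi x.
Implicit Types K L M : X -> X -> R.

Lemma zero_row_sumsE K x y : x != y -> zero_row_sums K x y = K x y.
Proof. by rewrite /zero_row_sums => /negbTE->. Qed.

Lemma generator_zero_row_sums K : (forall x y, x != y -> 0 <= K x y) ->
  generator (zero_row_sums K).
Proof.
move=> K0; split=> [x y xy|x]; first by rewrite zero_row_sumsE // K0.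
rewrite (bigD1 x) //= {1}/zero_row_sums eqxx addrC.
rewrite (eq_bigr (K x)) ?subrr // => y yx.
by rewrite zero_row_sumsE // eq_sym.
Qed.

Lemma generator_ext L M : generator L -> generator M ->
  (forall x y, x != y -> L x y = M x y) -> L = M.
Proof.
move=> [_ L0] [_ M0] LM; apply/funext => x; apply/funext => y.
have [<-|/LM//] := eqVneq x y.
have := etrans (L0 x) (esym (M0 x)); rewrite (bigD1 x) //= [RHS](bigD1 x) //=.
rewrite (eq_bigr (M x)) => [|z zx]; first exact: addIr.
by rewrite LM // eq_sym.
Qed.

Lemma dualE L x y : x != y -> dual pi L x y = pi y / pi x * L y x.
Proof. by move=> xy; rewrite /dual zero_row_sumsE. Qed.

Lemma generator_dual L : generator L -> generator (dual pi L).
Proof.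
move=> [L0 _]; apply: generator_zero_row_sums => x y xy.
by rewrite mulr_ge0 ?L0 1?eq_sym // divr_ge0 // ltW.
Qed.

(** Duality reverses the arrows of the flow pi x * L x y. *)
Lemma flow_dual L x y : x != y -> pi x * dual pi L x y = pi y * L y x.
Proof.
by move=> xy; rewrite dualE // mulrA [pi x * _]mulrC divfK // lt0r_neq0.
Qed.

Lemma dual_reversible M : reversible_generator pi M -> dual pi M = M.
Proof.
move=> [genM revM]; apply: generator_ext => // [|x y xy].
  exact: generator_dual.
by apply: (mulfI (lt0r_neq0 (pi_gt0 x))); rewrite flow_dual // revM.
Qed.

(** By homogeneity, the flow of the power mean is the power mean of the flows of
    [L] along (x, y) and (y, x), which is symmetric in x and y. *)
Lemma reversible_power_mean L p : p != 0 -> generator L ->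
  reversible_generator pi (power_mean_reversiblization pi L p).
Proof.
move=> p0 genL; split.
  by apply: generator_zero_row_sums => *; exact: power_mean_ge0.
move=> x y; have [->//|xy] := eqVneq x y.
have yx : y != x by rewrite eq_sym.
rewrite /power_mean_reversiblization.
rewrite (zero_row_sumsE _ xy) (zero_row_sumsE _ yx).
have [L_ge0 _] := genL; have [dL_ge0 _] := generator_dual genL.
rewrite -(power_mean_homogeneous p0 (pi_gt0 x) (L_ge0 x y xy) (dL_ge0 x y xy)).
rewrite -(power_mean_homogeneous p0 (pi_gt0 y) (L_ge0 y x yx) (dL_ge0 y x yx)).
by rewrite (flow_dual _ xy) (flow_dual _ yx) power_meanC.
Qed.

Lemma fdivE (f : R -> \bar R) M L :
  fdiv pi f M L =
  (\sum_(x : X) \sum_(y | y != x) (pi x)%:E * perspective f (M x y) (L x y))%E.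
Proof. by apply: eq_bigr => x _; rewrite gt0_sume_distrr. Qed.

(** Inside the double sum the weight turns the entries of a generator into flows,
    so that duality of both arguments only exchanges x and y. *)
Lemma fdiv_dual (f : R -> \bar R) M L :
  fdiv pi f (dual pi M) (dual pi L) = fdiv pi f M L.
Proof.
rewrite !fdivE (exchange_big_dep predT) //=; apply: eq_bigr => x _.
apply: eq_big => [y|y yx]; first by rewrite eq_sym.
rewrite !perspective_homogeneous ?lt0r_neq0 //.
by rewrite !flow_dual // eq_sym.
Qed.

Lemma fdiv_dualr (f : R -> \bar R) M L : reversible_generator pi M ->
  fdiv pi f M (dual pi L) = fdiv pi f M L.
Proof.
by move=> revM; rewrite -{1}(dual_reversible revM) fdiv_dual.
Qed.

Lemma fdiv_duall (f : R -> \bar R) M L : reversible_generator pi L ->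
  fdiv pi f (dual pi M) L = fdiv pi f M L.
Proof.
by move=> revL; rewrite -{1}(dual_reversible revL) fdiv_dual.
Qed.

Lemma fdiv_parallelogram (f : R -> \bar R) M1 L1 M2 L2 M3 L3 M4 L4 M5 L5 :
  (forall x y, x != y ->
    perspective f (M1 x y) (L1 x y) + perspective f (M2 x y) (L2 x y) =
    2%:E * perspective f (M3 x y) (L3 x y) +
    (perspective f (M4 x y) (L4 x y) + perspective f (M5 x y) (L5 x y)))%E ->
  (fdiv pi f M1 L1 + fdiv pi f M2 L2 =
   2%:E * fdiv pi f M3 L3 + (fdiv pi f M4 L4 + fdiv pi f M5 L5))%E.
Proof.
move=> fE; rewrite !fdivE gt0_sume_distrr // -!big_split /=.
apply: eq_bigr => x _; rewrite gt0_sume_distrr // -!big_split /=.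
apply: eq_bigr => y; rewrite eq_sym => xy.
by rewrite muleCA -!gt0_muleDr // fE.
Qed.

End Duality.

(** * The chi-square divergence between generators *)

Section Chi2Divergence.
Context {R : realType} {X : finType} (pi : X -> R).
Hypothesis pi_gt0 : forall x, 0 < pi x.
Implicit Types K L M : X -> X -> R.

Lemma D_chi2_term_ge0 M L x y : generator M -> generator L -> y != x ->
  (0 <= (pi x)%:E * perspective (@f_chi2 R) (M x y) (L x y))%E.
Proof.
move=> [M0 _] [L0 _] yx; apply: mule_ge0; first by rewrite lee_fin ltW.
by rewrite perspective_chi2_ge0 ?M0 ?L0 1?eq_sym.
Qed.

Lemma D_chi2_ge0 M L : generator M -> generator L -> (0 <= D_chi2 pi M L)%E.
Proof.
move=> genM genL; rewrite fdivE //.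
by apply: sume_ge0 => x _; apply: sume_ge0 => y; exact: D_chi2_term_ge0.
Qed.

(** A vanishing divergence forces equality off the diagonal, and the zero row
    sums determine the diagonal. *)
Lemma D_chi2_eq0 M L : generator M -> generator L ->
  D_chi2 pi M L = 0%E -> M = L.
Proof.
move=> genM genL D0; apply: generator_ext => // x y xy.
move/eqP: D0; rewrite fdivE // seq_psume_eq0 => [/allP/(_ x)|u _]; last first.
  by apply: sume_ge0 => v; exact: D_chi2_term_ge0.
rewrite mem_index_enum => /(_ isT) /=.
rewrite seq_psume_eq0 => [/allP/(_ y)|v]; last exact: D_chi2_term_ge0.
rewrite mem_index_enum eq_sym xy => /(_ isT) /=.
rewrite mule_eq0 eqe gt_eqF //= => /eqP.
by apply: perspective_chi2_eq0; [exact: genM.1|exact: genL.1].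
Qed.

Lemma D_chi2_fin_num M L : generator M -> generator L ->
  (forall x y, x != y -> L x y = 0 -> M x y = 0) ->
  D_chi2 pi M L \is a fin_num.
Proof.
move=> genM genL ML; rewrite ge0_fin_numE ?D_chi2_ge0 // fdivE //.
apply: lte_sum_pinfty => x _; apply: lte_sum_pinfty => y.
rewrite eq_sym => xy; apply: lte_mul_pinfty; rewrite ?lee_fin ?ltW //.
by apply: perspective_chi2_lty; [exact: genM.1|exact: genL.1|exact: ML].
Qed.

Lemma D_m1E M L : generator M -> generator L ->
  D_m1 pi M L = ((2^-1)%:E * D_chi2 pi L M)%E.
Proof.
move=> [M0 _] [L0 _]; rewrite !fdivE // gt0_sume_distrr ?invr_gt0 //.
apply: eq_bigr => x _; rewrite gt0_sume_distrr ?invr_gt0 //.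
apply: eq_bigr => y; rewrite eq_sym => xy.
by rewrite perspective_f_alpha_m1 ?M0 ?L0 // muleCA.
Qed.

End Chi2Divergence.

(** * Minimizers from Pythagorean identities *)

Section Minimizers.
Context {R : realType} {T : Type}.
Implicit Types (A : set T) (F G : T -> \bar R).

(** [G] plays the part of the divergence between the foot [m] and the competitor.
    Finiteness of [F m] is essential: it lets [F M <= F m] cancel to [G M <= 0]. *)
Lemma unique_minimizer_pythagoras A F G (m : T) : A m -> F m \is a fin_num ->
  (forall M, A M -> 0 <= G M)%E -> (forall M, A M -> G M = 0%E -> M = m) ->
  (forall M, A M -> F M = F m + G M)%E -> unique_minimizer A F m.
Proof.
move=> Am Fm G_ge0 G_eq0 FE; split=> // [M AM|M AM minM].
  by rewrite (FE M AM) leeDl // G_ge0.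
apply: G_eq0 => //; apply/eqP; rewrite eq_le G_ge0 // andbT.
by have := minM m Am; rewrite (FE M AM) -leeBrDl // subee.
Qed.

Lemma unique_minimizer_scale A F G (k : R) (m : T) : 0 < k ->
  (forall M, A M -> G M = k%:E * F M)%E ->
  unique_minimizer A F m -> unique_minimizer A G m.
Proof.
move=> k0 GE [Am minm uniqm].
have leG M N : A M -> A N -> (G M <= G N)%E = (F M <= F N)%E.
  by move=> AM AN; rewrite !GE // lee_pmul2l.
split=> // [M AM|M AM minM]; first by rewrite leG // minm.
by apply: uniqm => // N AN; rewrite -leG // minM.
Qed.

End Minimizers.

(** * Reversiblizations and their geometry *)

Theorem corollary3p1 (R : realType) (X : finType) (pi : X -> R)
    (pi_gt0 : forall x, 0 < pi x) (pi_sum1 : \sum_(x : X) pi x = 1)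
    (L : X -> X -> R) (genL : generator L) :
  let Lpi := dual pi L in
  let Mf := power_mean_reversiblization pi L (-1) in
  let Mfs := power_mean_reversiblization pi L 2 in
  (* (1) *)
  (unique_minimizer (reversible_generator pi) (fun M => D_chi2 pi M L) Mf /\
   unique_minimizer (reversible_generator pi) (fun M => D_m1 pi L M) Mf /\
   (forall x y, x != y ->
      Mf x y = if (L x y == 0) || (Lpi x y == 0) then 0
               else (((L x y)^-1 + (Lpi x y)^-1) / 2)^-1)) /\
  (* (2) *)
  (unique_minimizer (reversible_generator pi) (fun M => D_chi2 pi L M) Mfs /\
   unique_minimizer (reversible_generator pi) (fun M => D_m1 pi M L) Mfs /\
   (forall x y, x != y ->
      Mfs x y = Num.sqrt (((L x y) ^+ 2 + (Lpi x y) ^+ 2) / 2))) /\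
  (* (3) Pythagorean identity *)
  (forall Mbar, reversible_generator pi Mbar ->
     D_chi2 pi L Mbar = (D_chi2 pi L Mfs + D_chi2 pi Mfs Mbar)%E /\
     D_chi2 pi Mbar L = (D_chi2 pi Mbar Mf + D_chi2 pi Mf L)%E) /\
  (* (4) bisection property *)
  (D_chi2 pi L Mfs = D_chi2 pi Lpi Mfs /\
   D_chi2 pi Mf L = D_chi2 pi Mf Lpi) /\
  (* (5) parallelogram law *)
  (forall Mbar, reversible_generator pi Mbar ->
     (D_chi2 pi L Mbar + D_chi2 pi Lpi Mbar =
      2%:E * D_chi2 pi L Mfs + 2%:E * D_chi2 pi Mfs Mbar)%E /\
     (D_chi2 pi Mbar L + D_chi2 pi Mbar Lpi =
      2%:E * D_chi2 pi Mbar Mf + 2%:E * D_chi2 pi Mf L)%E).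

Proof.
move=> Lpi Mf Mfs.
have genLpi : generator Lpi := generator_dual pi_gt0 genL.
have revMf : reversible_generator pi Mf.
  by apply: reversible_power_mean => //; rewrite oppr_eq0 oner_eq0.
have revMfs : reversible_generator pi Mfs by exact: reversible_power_mean.
have MfE x y : x != y -> Mf x y = power_mean (-1) (L x y) (Lpi x y).
  exact: zero_row_sumsE.
have MfsE x y : x != y -> Mfs x y = power_mean 2 (L x y) (Lpi x y).
  exact: zero_row_sumsE.
have L0 x y : x != y -> 0 <= L x y by exact: genL.1.
have Lpi0 x y : x != y -> 0 <= Lpi x y by exact: genLpi.1.
have bisect_fs : D_chi2 pi Lpi Mfs = D_chi2 pi L Mfs by exact: fdiv_duall.
have bisect_f : D_chi2 pi Mf Lpi = D_chi2 pi Mf L by exact: fdiv_dualr.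
have pythagoras_f M : reversible_generator pi M ->
    (D_chi2 pi M L = D_chi2 pi M Mf + D_chi2 pi Mf L)%E.
  move=> revM; apply: halve_parallelogram.
  (* Bisection turns one copy of each divergence to L into one to Lpi. *)
  rewrite -{2}(fdiv_dualr _ _ _ revM) // -{2}bisect_f.
  apply: fdiv_parallelogram => // x y xy; rewrite !MfE //.
  by apply: chi2_harmonic_mean; rewrite ?L0 ?Lpi0 ?revM.1.1.
have pythagoras_fs M : reversible_generator pi M ->
    (D_chi2 pi L M = D_chi2 pi L Mfs + D_chi2 pi Mfs M)%E.
  move=> revM; rewrite addeC; apply: halve_parallelogram.
  rewrite -{2}(fdiv_duall _ _ _ revM) // -{2}bisect_fs.
  apply: fdiv_parallelogram => // x y xy; rewrite !MfsE //.
  by apply: chi2_quadratic_mean; rewrite ?L0 ?Lpi0 ?revM.1.1.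
have min_f : unique_minimizer (reversible_generator pi)
    (fun M => D_chi2 pi M L) Mf.
  apply: (@unique_minimizer_pythagoras _ _ _ _ (fun M => D_chi2 pi M Mf)) => //.
  - apply: D_chi2_fin_num => //; first exact: revMf.1.
    by move=> x y xy Lxy; rewrite MfE // power_mean_m1_eq0 ?L0 ?Lpi0 //; left.
  - by move=> M [genM _]; apply: D_chi2_ge0 => //; exact: revMf.1.
  - by move=> M [genM _]; apply: D_chi2_eq0 => //; exact: revMf.1.
  - by move=> M revM; rewrite addeC pythagoras_f.
have min_fs : unique_minimizer (reversible_generator pi)
    (fun M => D_chi2 pi L M) Mfs.
  apply: (@unique_minimizer_pythagoras _ _ _ _ (fun M => D_chi2 pi Mfs M)) => //.
  - apply: D_chi2_fin_num => //; first exact: revMfs.1.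
    move=> x y xy; rewrite MfsE // => c0.
    by have [] := power_mean_2_eq0 (L0 x y xy) (Lpi0 x y xy) c0.
  - by move=> M [genM _]; apply: D_chi2_ge0 => //; exact: revMfs.1.
  - move=> M [genM _] D0; apply/esym; apply: D_chi2_eq0 D0 => //.
    exact: revMfs.1.
have half_gt0 : 0 < 2^-1 :> R by rewrite invr_gt0.
split; last split; last split; last split.
- split; first exact: min_f.
  split=> [|x y xy]; last by rewrite MfE // power_mean_m1 ?L0 ?Lpi0.
  apply: unique_minimizer_scale half_gt0 _ min_f => M [genM _].
  exact: D_m1E.
- split; first exact: min_fs.
  split=> [|x y xy]; last by rewrite MfsE // power_mean_2 ?L0 ?Lpi0.
  apply: unique_minimizer_scale half_gt0 _ min_fs => M [genM _].
  exact: D_m1E.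
- by move=> M revM; split; [exact: pythagoras_fs|exact: pythagoras_f].
- by [].
- move=> M revM; rewrite fdiv_duall // fdiv_dualr //.
  by split; rewrite -gt0_muleDr // mul2e; rewrite -(pythagoras_fs, pythagoras_f).
Qed.
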